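(* Let $m\ge 1$ be an integer. For every integer $N\ge 0$ let $H_N=\det\left(\gamma^{(2m)}_{i+j-m}(t)\right)_{i,j=0}^{N-1}$ (with $H_0=1$). Then $$H_N=\begin{cases}1, & \text{if } N=0,\\ -\xi_1\, t^{m(n-1)(mn-2)/2}\,[n-1]_{t^m}, & \text{if } N=mn \text{ with } n\ge 1,\\ (-1)^m\xi_1\, t^{m^2n(n-1)/2}\,[n]_{t^m}, & \text{if } N=mn+1 \text{ with } n\ge 0,\\ 0, & \text{otherwise},\end{cases}$$ where $\xi_1=(-1)^{nm(m-1)/2}$.
   Context: The Narayana polynomials are $\gamma_n(t)=\sum_{k=0}^{n}\binom{n}{k}\binom{n-1}{k}\frac{1}{k+1}t^k$ (so $\gamma_0(t)=1$), with generating function $\gamma(t,q)=\sum_{n\ge0}\gamma_n(t)q^n$, which satisfies $-1+(1-q+tq)\gamma(t,q)-tq\,\gamma(t,q)^2=0$. Let $G(t,q)=(\gamma(t,q)-1)/q$. For $m\ge1$ the polynomials $\gamma^{(2m)}_n(t)$ are defined by $\sum_{n\ge0}\gamma^{(2m)}_n(t)q^n=G(t,q)^m$, and $\gamma^{(2m)}_i(t)=0$ for $i<0$. Equivalently, $\gamma^{(2m)}_{n-m}(t)$ is the coefficient of $q^n$ in $(\gamma(t,q)-1)^m$. The $q$-number is $[n]_x=1+x+\cdots+x^{n-1}$ (so $[0]_x=0$). *)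

(* Defs.v *)
From HB Require Import structures.
From mathcomp Require Import all_boot all_order all_algebra.
Set Implicit Arguments. Unset Strict Implicit. Unset Printing Implicit Defensive.
Import Order.TTheory GRing.Theory Num.Theory.
Local Open Scope ring_scope.

Definition narayana (n : nat) : {poly rat} :=
  if n is 0 then 1 else
  \sum_(0 <= k < n.+1)
     (('C(n, k) * 'C(n.-1, k))%:R / (k.+1)%:R : rat) *: 'X^k.

(* Truncation of gamma(t,q) - 1 = sum_{n>=1} gamma_n(t) q^n to degree <= K in q,
   as a polynomial in q with coefficients in {poly rat}. *)
Definition gamma_minus1_trunc (K : nat) : {poly {poly rat}} :=
  \sum_(1 <= n < K.+1) (narayana n)%:P * 'X^n.

(* coefficient of q^K in (gamma(t,q) - 1)^m  (the truncation does not affect it) *)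
Definition coef_gm1_pow (m K : nat) : {poly rat} :=
  ((gamma_minus1_trunc K) ^+ m)`_K.

(* gamma^{(2m)}_i(t): coefficient of q^i in G(t,q)^m, i.e. coefficient of q^{i+m}
   in (gamma - 1)^m;  zero for negative i. *)
Definition gamma2m (m : nat) (i : int) : {poly rat} :=
  match i with
  | Posz n => coef_gm1_pow m (n + m)
  | Negz _ => 0
  end.

Definition hankelH (m N : nat) : {poly rat} :=
  \det (\matrix_(i < N, j < N) gamma2m m (i%:Z + j%:Z - m%:Z)).

Definition qnum (n : nat) (x : {poly rat}) : {poly rat} := \sum_(i < n) x ^+ i.

Definition xi1 (m n : nat) : {poly rat} := (-1) ^+ ((n * m * (m - 1)) %/ 2).

(* Main.v *)
(** Put [y = gamma - 1]. Then [y = q (1 + y) (1 + t y)], so the coefficients [ballot p k] of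
    [q^k] in [y^p] satisfy a three-term recurrence and [H_N] is the Gram determinant of the
    functional [L_m : 'X^k |-> ballot m k] on polynomials of degree [< N].
    Parametrize ['X = 1/q] as [1/y + (1 + t) + t y] and let [P = y^(-m) + (t y)^m], a monic
    polynomial of degree [m] in ['X]. As [t^m Y^2 - P Y + 1 = 0] for [Y = y^m], the monic
    polynomials [Q_(n+1) = P Q_n - t^m Q_(n-1)] satisfy
    [L_m (Q_n f) = t^(mn) L_(m(n+1)) f + (-1)^(m(n+1)) [n]_(t^m) f(0)],
    and [L_p] vanishes on degrees [< p]. In the row basis ['X^i Q_n] ([i < m]) and the column
    basis ['X^j], row [mn] of the Gram matrix of size [mn + r + 1] ([r < m]) is supported on
    column [0]; removing both leaves a block triangular matrix with [n] antitriangular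
    diagonal blocks of size [m] and a last block of size [r] whose first row is zero unless
    [r = 0] or [r = m - 1]. *)
Require Import Defs.
From HB Require Import structures.
From mathcomp Require Import all_boot all_order all_algebra.
From mathcomp Require Import ring zify.
Import Order.TTheory GRing.Theory Num.Theory.
Local Open Scope ring_scope.

Set Implicit Arguments. Unset Strict Implicit.

(** * Powers of [y], their linear functionals, and the polynomials [Q_n] *)

Section Ballot.

Context {R : comNzRingType} (t : R).
Implicit Types (p q k n m i j : nat) (f g : {poly R}).

(** Coefficientwise form of [y^(p+1) = q (y^p + (1 + t) y^(p+1) + t y^(p+2))]. *)
Fixpoint ballot p k {struct k} : R :=
  if k is k'.+1 then
    if p is p'.+1 then
      ballot p' k' + (1 + t) * ballot p'.+1 k' + t * ballot p'.+2 k'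
    else 0
  else (p == 0)%:R.

Lemma ballot0n k : ballot 0 k = (k == 0)%:R.
Proof. by case: k. Qed.

Lemma ballotSS p k : ballot p.+1 k.+1 =
  ballot p k + (1 + t) * ballot p.+1 k + t * ballot p.+2 k.
Proof. by []. Qed.

Lemma ballot_lt p k : (k < p)%N -> ballot p k = 0.
Proof.
elim: k p => [|k IHk] [|p] //= ltkp.
by rewrite !IHk ?mulr0 ?addr0 ?mulr0 ?addr0 //; lia.
Qed.

Lemma ballot_diag p : ballot p p = 1.
Proof. by elim: p => //= p ->; rewrite !ballot_lt ?mulr0 ?addr0 ?mulr0 ?addr0. Qed.

Lemma ballot_conv p q k :
  \sum_(i < k.+1) ballot p i * ballot q (k - i) = ballot (p + q) k.
Proof.
elim: k p => [|k IHk] [|p].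
- by rewrite big_ord1 /= mul1r.
- by rewrite big_ord1 /= mul0r.
- rewrite big_ord_recl big1 /= ?mul1r ?addr0 // => i _.
  by rewrite mul0r.
rewrite big_ord_recl /= mul0r add0r -!(addSn, IHk) !big_distrr -!big_split /=.
by apply: eq_bigr => i _; rewrite subSS; ring.
Qed.

Definition ballot_form p f : R := \sum_(k < size f) f`_k * ballot p k.

Lemma ballot_formE {p} n f :
  (size f <= n)%N -> ballot_form p f = \sum_(k < n) f`_k * ballot p k.
Proof.
move=> le_fn; rewrite /ballot_form (big_ord_widen n (fun k => f`_k * ballot p k)) //.
rewrite big_mkcond; apply: eq_bigr => k _.
by case: ltnP => // le_fk; rewrite nth_default // mul0r.
Qed.

Lemma ballot_form_is_linear p : scalar (ballot_form p).
Proof.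
move=> a f g; pose n := maxn (size f) (size g).
have le_fn: (size f <= n)%N by apply: leq_maxl.
have le_gn: (size g <= n)%N by apply: leq_maxr.
rewrite (ballot_formE le_fn) (ballot_formE le_gn) (@ballot_formE p n).
  rewrite big_distrr -big_split; apply: eq_bigr => k _ /=.
  by rewrite coefD coefZ mulrDl mulrA.
by rewrite (leq_trans (size_polyD _ _)) // geq_max le_gn (leq_trans (size_scale_leq _ _)).
Qed.

HB.instance Definition _ p :=
  GRing.isLinear.Build R {poly R} R *%R (ballot_form p) (ballot_form_is_linear p).

Lemma ballot_form0 f : ballot_form 0 f = f`_0.
Proof.
rewrite (@ballot_formE _ (size f).+1) // big_ord_recl /= mulr1 big1 ?addr0 // => i _.
by rewrite mulr0.
Qed.

Lemma ballot_formXn p k : ballot_form p 'X^k = ballot p k.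
Proof.
rewrite /ballot_form size_polyXn big_ord_recr /= coefXn eqxx mul1r big1 ?add0r //.
by move=> i _; rewrite coefXn ltn_eqF ?mul0r.
Qed.

(** [L_p f] is the constant term in [q] of [f(1/q) y^p], and [1/q = 1/y + (1 + t) + t y]. *)
Lemma ballot_formMX p f :
  ballot_form p.+1 ('X * f) =
    ballot_form p f + (1 + t) * ballot_form p.+1 f + t * ballot_form p.+2 f.
Proof.
rewrite (@ballot_formE _ (size f).+1); last first.
  by rewrite (leq_trans (size_polyMleq _ _)) // size_polyX.
rewrite /ballot_form big_ord_recl coefXM mul0r add0r !big_distrr -!big_split.
by apply: eq_bigr => k _; rewrite coefXM /=; ring.
Qed.

(* With ['X = 1/y + (1 + t) + t y], this is [y^(-n) + (t y)^n]. *)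
Fixpoint lucas n : {poly R} :=
  if n is n'.+1 then
    if n' is n''.+1 then ('X - (1 + t)%:P) * lucas n' - t *: lucas n''
    else 'X - (1 + t)%:P
  else 2%:R.

Lemma lucasSS n :
  lucas n.+2 = ('X - (1 + t)%:P) * lucas n.+1 - t *: lucas n.
Proof. by []. Qed.

Lemma nat_ind2 (P : nat -> Prop) :
  P 0 -> P 1 -> (forall n, P n -> P n.+1 -> P n.+2) -> forall n, P n.
Proof.
move=> P0 P1 PSS n; suff []: P n /\ P n.+1 by [].
by elim: n => // n [] *; split=> //; apply: PSS.
Qed.

Lemma monicB_size f g :
  f \is monic -> (size g < size f)%N -> f - g \is monic /\ size (f - g) = size f.
Proof.
move=> monf ltgf; split; last by rewrite size_polyDl ?size_polyN.
by rewrite monicE lead_coefDl ?size_polyN // -monicE.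
Qed.

Lemma lucas_monic n : (0 < n)%N -> lucas n \is monic /\ size (lucas n) = n.+1.
Proof.
elim/nat_ind2: n => // [_|n IHn0 IHn1 _]; first by rewrite monicXsubC size_XsubC.
have [//|mon1 size1] := IHn1.
have monM : ('X - (1 + t)%:P) * lucas n.+1 \is monic.
  by rewrite monicMl ?monicXsubC.
have sizeM : size (('X - (1 + t)%:P) * lucas n.+1) = n.+3.
  by rewrite size_monicM ?monicXsubC ?monic_neq0 // size_XsubC size1.
rewrite lucasSS -sizeM; apply: monicB_size => //.
rewrite sizeM (leq_ltn_trans (size_scale_leq _ _)) // ltnS.
(* [lucas 0 = 2] escapes the induction hypothesis; 2 may even vanish in [R], but its size is at most
   1. *)
case: n IHn0 {IHn1 mon1 size1 monM sizeM} => [_|n [//|_ ->]] //.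
by rewrite /= -polyC_natr size_polyC; case: eqP.
Qed.

(** At ['X = 0] the pair [1/y], [t y] has sum [-(1 + t)] and product [t], so it consists of [-1] and
    [-t]. *)
Lemma lucas_coef0 n : (lucas n)`_0 = (-1) ^+ n * (1 + t ^+ n).
Proof.
elim/nat_ind2: n => [||n IHn0 IHn1].
- by rewrite /= -polyC_natr coefC /= expr0; ring.
- by rewrite /= coefB coefX coefC /= !expr1; ring.
by rewrite lucasSS coefB coef0M coefB coefX coefC coefZ IHn0 IHn1 /= !exprS; ring.
Qed.

(** This is [(y^(-n) + (t y)^n) y^(n+p) = y^p + t^n y^(2n+p)] under the functionals. *)
Lemma ballot_form_lucas n p f :
  ballot_form (n + p) (lucas n * f) =
    ballot_form p f + t ^+ n * ballot_form (n + n + p) f.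
Proof.
elim/nat_ind2: n p f => [||n IHn0 IHn1] p f.
- by rewrite /= mulr_natl raddfMn /=; ring.
- by rewrite /= mulrBl mul_polyC linearB linearZ /= ballot_formMX; ring.
(* Moving ['X] onto [f] lets the hypotheses apply, with [n.+2 + p] read as [n.+1 + p.+1] and
   [n + p.+2]. *)
have -> : lucas n.+2 * f
    = lucas n.+1 * ('X * f) - (1 + t) *: (lucas n.+1 * f) - t *: (lucas n * f).
  by rewrite lucasSS -!mul_polyC; ring.
rewrite !linearB !linearZ /=.
have := IHn1 p.+1 ('X * f); have := IHn1 p.+1 f; have := IHn0 p.+2 f.
rewrite !addnS !addSn => -> -> ->; rewrite !ballot_formMX !exprS.
by ring.
Qed.

(* [(y^(-m(n+1)) - (t y)^(m(n+1))) / (y^(-m) - (t y)^m)] in the same parametrization. *)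
Fixpoint orth m n : {poly R} :=
  if n is n'.+1 then
    if n' is n''.+1 then lucas m * orth m n' - t ^+ m *: orth m n'' else lucas m
  else 1.

Lemma orthSS m n :
  orth m n.+2 = lucas m * orth m n.+1 - t ^+ m *: orth m n.
Proof. by []. Qed.

Lemma orth_monic m n :
  (0 < m)%N -> orth m n \is monic /\ size (orth m n) = (m * n).+1.
Proof.
move=> m_gt0; have [monP sizeP] := lucas_monic m_gt0.
elim/nat_ind2: n => [||n [mon0 size0] [mon1 size1]].
- by rewrite /= monic1 size_poly1 muln0.
- by rewrite /= muln1.
have sizeM : size (lucas m * orth m n.+1) = (m * n.+2).+1.
  by rewrite size_monicM ?monic_neq0 // sizeP size1; lia.
rewrite orthSS -sizeM; apply: monicB_size; first by rewrite monicMl.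
by rewrite sizeM (leq_ltn_trans (size_scale_leq _ _)) // size0; nia.
Qed.

Lemma ballot_form_orth m n f :
  ballot_form m (orth m n * f) = t ^+ (m * n) * ballot_form (m * n.+1) f
    + (-1) ^+ (m * n.+1) * (\sum_(i < n) (t ^+ m) ^+ i) * f`_0.
Proof.
elim/nat_ind2: n f => [||n IHn0 IHn1] f.
- by rewrite /= big_ord0 mulr0 mul0r addr0 muln0 muln1 !mul1r.
(* The value [f(0)] enters here, as [L_0 f]. *)
- have := ballot_form_lucas m 0 f.
  rewrite addn0 ballot_form0 /= => ->; rewrite big_ord1 muln1.
  have -> : (m * 2 = m + m)%N by lia.
  by rewrite addn0 addnn -muln2 mulnC exprM sqrrN expr1n expr1n; ring.
(* The [L_(m(n+1)) f] terms cancel; with [x = t^m], the [f(0)] terms combine by [(1 + x) [n+1]_x - x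
   [n]_x = [n+2]_x]. *)
have -> : orth m n.+2 * f
    = orth m n.+1 * (lucas m * f) - t ^+ m *: (orth m n * f).
  by rewrite orthSS -!mul_polyC; ring.
rewrite linearB linearZ /= IHn0 IHn1 coef0M lucas_coef0.
have -> : (m * n.+2 = m + m * n.+1)%N by lia.
rewrite ballot_form_lucas.
have -> : (m + m + m * n.+1 = m * n.+3)%N by lia.
have -> : (m * n.+3 = m + (m + m * n.+1))%N by lia.
have -> : (m * n.+1 = m + m * n)%N by lia.
rewrite !big_ord_recr /= !exprD -!exprM.
set S := \sum_(i < n) _; have : (-1) ^+ m * (-1) ^+ m = 1 :> R.
  by rewrite -exprMn mulrNN mulr1 expr1n.
have -> : (m * n.+1 = m + m * n)%N by lia.
rewrite exprD; move: ((-1) ^+ m) (t ^+ m) => u v uu.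
move: ((-1) ^+ (m * n)) (t ^+ (m * n)) => w x.
ring: uu.
Qed.

Lemma ballot_form_XorthX m n i j :
  ballot_form m ('X^i * orth m n * 'X^j) = t ^+ (m * n) * ballot (m * n.+1) (i + j)
    + (-1) ^+ (m * n.+1) * (\sum_(l < n) (t ^+ m) ^+ l) * (i + j == 0)%N%:R.
Proof.
have -> : 'X^i * orth m n * 'X^j = orth m n * 'X^(i + j).
  by rewrite exprD; ring.
by rewrite ballot_form_orth ballot_formXn coefXn eq_sym.
Qed.

End Ballot.

(** * Determinants of structured matrices *)

Section Determinants.

Context {R : comNzRingType}.
Implicit Types (f : nat -> nat -> R).

(** Entries indexed by naturals make blocks and minors mere index shifts, without casts between
    ordinals. *)
Definition sqdet f N : R := \det (\matrix_(i < N, j < N) f i j).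

Lemma eq_sqdet f g N :
  (forall i j, (i < N)%N -> (j < N)%N -> f i j = g i j) -> sqdet f N = sqdet g N.
Proof.
by move=> eq_fg; congr (\det _); apply/matrixP=> i j; rewrite !mxE eq_fg.
Qed.

Lemma sqdet0 f : sqdet f 0 = 1.
Proof. exact: det_mx00. Qed.

Lemma sqdet_block f p q :
  (forall i j, (p <= i < p + q)%N -> (j < p)%N -> f i j = 0) ->
  sqdet f (p + q) = sqdet f p * sqdet (fun i j => f (p + i)%N (p + j)%N) q.
Proof.
move=> f0; rewrite /sqdet.
rewrite -(@det_ublock _ p q _ (\matrix_(i, j) f i (p + j)%N)); congr (\det _).
apply/matrixP=> i j; case: (split_ordP i) => i' ->; case: (split_ordP j) => j' ->.
- by rewrite block_mxEul !mxE.
- by rewrite block_mxEur !mxE.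
- by rewrite block_mxEdl !mxE /= f0 // leq_addr ltn_add2l ltn_ord.
- by rewrite block_mxEdr !mxE.
Qed.

Lemma sqdet_row0 f N k : (k < N)%N -> (forall j, (j < N)%N -> f k j = 0) -> sqdet f N = 0.
Proof.
move=> ltkN f0; rewrite /sqdet (expand_det_row _ (Ordinal ltkN)) big1 // => j _.
by rewrite mxE f0 // mul0r.
Qed.

Lemma sqdet_row_col0 f N k :
  (k <= N)%N -> (forall j, (0 < j <= N)%N -> f k j = 0) ->
  sqdet f N.+1 = (-1) ^+ k * f k 0 * sqdet (fun i j => f (bump k i) j.+1) N.
Proof.
rewrite -ltnS => ltkN f0; rewrite /sqdet (expand_det_row _ (Ordinal ltkN)).
rewrite big_ord_recl big1 => [|j _]; last by rewrite mxE f0 ?mul0r //= ltn_ord.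
rewrite addr0 mxE /cofactor addn0 mulrCA mulrA; congr (_ * \det _).
by apply/matrixP=> i j; rewrite !mxE.
Qed.

(** Only the last entry of the first row survives, with sign [(-1)^(N-1)]; its minor has the same
    shape. *)
Lemma sqdet_antitrig f c N :
  (forall i j, (i < N)%N -> (j < N)%N -> (i + j < N.-1)%N -> f i j = 0) ->
  (forall i j, (i + j).+1 = N -> f i j = c) ->
  sqdet f N = (-1) ^+ 'C(N, 2) * c ^+ N.
Proof.
elim: N f => [|N IHN] f f0 fc; first by rewrite sqdet0 mulr1.
rewrite /sqdet (expand_det_row _ ord0) big_ord_recr big1 /= => [|j _]; last first.
  by have ltjN := ltn_ord j; rewrite mxE f0 ?mul0r //= ltnS ltnW.
rewrite add0r mxE fc // /cofactor /= add0n.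
have -> : \det (row' ord0 (col' ord_max (\matrix_(i < N.+1, j < N.+1) f i j)))
    = sqdet (fun i j => f i.+1 j) N.
  by congr (\det _); apply/matrixP=> i j; rewrite !mxE /= [bump N j]/bump leqNgt ltn_ord.
rewrite IHN => [|i j ltiN ltjN ltij|i j eqN].
- by rewrite binS bin1 exprD exprS; ring.
- by apply: f0; lia.
- by apply: fc; lia.
Qed.

End Determinants.

(** * The Gram matrix in the adapted row basis *)

Section BallotHankel.

Context {R : comNzRingType} (t : R) (m : nat).
Hypothesis m_gt0 : (0 < m)%N.

(** Euclidean division by [m] numbers the row basis so that its [k]-th member has degree [k]. *)
Definition orth_gram k j : R :=
  ballot_form t m ('X^(k %% m) * orth t m (k %/ m) * 'X^j).

(** The row change of basis is unitriangular, its [k]-th polynomial being monic of degree [k]. *)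
Lemma sqdet_ballotE N :
  sqdet (fun i j => ballot t m (i + j)) N = sqdet orth_gram N.
Proof.
pose e k : {poly R} := 'X^(k %% m) * orth t m (k %/ m).
have mon_e k : e k \is monic by rewrite rpredM ?monicXn ?(orth_monic t _ m_gt0).1.
have size_e k : size (e k) = k.+1.
  have [mon_o size_o] := orth_monic t (k %/ m) m_gt0.
  rewrite size_monicM ?monicXn ?monic_neq0 // size_polyXn size_o addSn /=.
  by rewrite addnS addnC mulnC -divn_eq.
pose T : 'M[R]_N := \matrix_(k, l) (e k)`_l.
have detT : \det T = 1.
  rewrite det_trig; last first.
    by apply/is_trig_mxP=> k l ltkl; rewrite mxE nth_default // size_e.
  rewrite big1 // => k _; rewrite mxE.
  by have /monicP := mon_e k; rewrite lead_coefE size_e.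
rewrite /sqdet -[LHS]mul1r -detT -det_mulmx; congr (\det _).
apply/matrixP=> k j; rewrite !mxE /orth_gram -/(e k).
have -> : e k * 'X^j = \sum_(l < N) (e k)`_l *: 'X^(l + j).
  rewrite -{1}[e k]coefK size_e poly_def (big_ord_widen N (fun l => (e k)`_l *: 'X^l)) //.
  rewrite big_mkcond mulr_suml; apply: eq_bigr => l _; rewrite exprD scalerAl.
  by case: ltnP => // ltkl; rewrite nth_default ?size_e // scale0r.
rewrite linear_sum; apply: eq_bigr => l _.
by rewrite linearZ !mxE /= ballot_formXn.
Qed.

Lemma orth_gramE n i j : (i < m)%N -> orth_gram (m * n + i) j
  = t ^+ (m * n) * ballot t (m * n.+1) (i + j)
    + (-1) ^+ (m * n.+1) * (\sum_(l < n) (t ^+ m) ^+ l) * (i + j == 0)%N%:R.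
Proof.
move=> ltim; rewrite /orth_gram -ballot_form_XorthX mulnC modnMDl divnMDl //.
by rewrite modn_small // divn_small // addn0.
Qed.

(** [L_(m(n+1))] kills degrees below [m(n+1)], and [0 < j] kills the value at 0. *)
Lemma orth_gram_eq0 n i j : (i < m)%N -> (0 < j)%N -> (i + j < m * n.+1)%N ->
  orth_gram (m * n + i) j = 0.
Proof.
move=> ltim j_gt0 ltij; rewrite orth_gramE // ballot_lt // mulr0 add0r.
by rewrite addn_eq0 (gtn_eqF j_gt0) andbF mulr0.
Qed.

Lemma orth_gram_diag n i j : (i < m)%N -> (0 < j)%N -> (i + j = m * n.+1)%N ->
  orth_gram (m * n + i) j = t ^+ (m * n).
Proof.
move=> ltim j_gt0 eqij; rewrite orth_gramE // eqij ballot_diag mulr1.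
by rewrite muln_eq0 (gtn_eqF m_gt0) mulr0 addr0.
Qed.

(** Without column 0 the matrix is block triangular; the diagonal block of index [n] is
    antitriangular with [t^(mn)] on its antidiagonal. *)
Lemma sqdet_orth_gram_shift n :
  sqdet (fun i j => orth_gram i j.+1) (m * n)
    = (-1) ^+ (n * 'C(m, 2)) * t ^+ (m * m * 'C(n, 2)).
Proof.
elim: n => [|n IHn]; first by rewrite muln0 sqdet0 muln0 mulr1.
rewrite mulnS addnC sqdet_block; last first.
  move=> i j /andP[leni ltin] ltjn; rewrite -(subnKC leni).
  by apply: orth_gram_eq0; lia.
rewrite IHn (@sqdet_antitrig _ _ (t ^+ (m * n))).
- rewrite -exprM ['C(n.+1, 2)]binS bin1 mulSn mulnDr !exprD (mulnAC m n m).
  by move: (t ^+ _) ((-1) ^+ _) (t ^+ _) ((-1) ^+ _) => a b c d; ring.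
- by move=> i j *; apply: orth_gram_eq0; lia.
- by move=> i j *; apply: orth_gram_diag; lia.
Qed.

Lemma sqdet_ballot_split n r : (r < m)%N ->
  sqdet (fun i j => ballot t m (i + j)) (m * n + r).+1
    = (-1) ^+ m * (\sum_(l < n) (t ^+ m) ^+ l)
      * ((-1) ^+ (n * 'C(m, 2)) * t ^+ (m * m * 'C(n, 2)))
      * sqdet (fun i j => orth_gram (m * n + i.+1) (m * n + j).+1) r.
Proof.
move=> ltrm; rewrite sqdet_ballotE (@sqdet_row_col0 _ _ _ (m * n)) ?leq_addr //.
  rewrite -{2}[(m * n)%N]addn0 orth_gramE // ballot_lt ?muln_gt0 ?m_gt0 //.
  (* Deleting row [m * n] moves up only the rows of the last block, hence its [i.+1]. *)
  rewrite mulr0 add0r mulr1 sqdet_block; last first.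
    move=> i j /andP[leni ltin] ltjn; rewrite -(subnKC leni).
    by rewrite /bump leq_addr add1n -addnS; apply: orth_gram_eq0; lia.
  rewrite -sqdet_orth_gram_shift !mulrA -exprD.
  (* One sign comes from the cofactor, the other from the pivot entry. *)
  have -> : (-1) ^+ (m * n + m * n.+1) = (-1) ^+ m :> R.
    have -> : (m * n + m * n.+1 = m + 2 * (m * n))%N by lia.
    by rewrite exprD exprM sqrrN expr1n expr1n mulr1.
  congr (_ * _ * _); apply: eq_sqdet => i j lti ltj.
    by rewrite /bump leqNgt lti.
  by rewrite /bump leq_addr add1n addnS.
by move=> j /andP[j_gt0 lej]; rewrite -[(m * n)%N]addn0; apply: orth_gram_eq0; lia.
Qed.

End BallotHankel.

(** * Narayana polynomials as ballot coefficients *)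

Section Narayana.

(* ['C(n, k - 1)], read as [0] for [k = 0]. *)
Definition bin_pred n k : nat := if k is k'.+1 then 'C(n, k') else 0.

Lemma binS_pred n k : 'C(n.+1, k) = ('C(n, k) + bin_pred n k)%N.
Proof. by case: k => [|k]; rewrite ?bin0 ?binS. Qed.

(* Reflection principle for Motzkin paths with two-coloured level steps. *)
Lemma ballot_coef p k s : (ballot ('X : {poly rat}) p k.+1)`_s =
  'C(k, s)%:R * (bin_pred k (p + s))%:R - (bin_pred k s)%:R * 'C(k, p + s)%:R.
Proof.
elim: k p s => [|k IHk] [|p] s.
- by rewrite /= coef0 add0n mulrC subrr.
- rewrite /= !mulr0 !addr0.
  by case: p s => [|p] [|s]; rewrite /= ?coef1 ?coef0 ?mulr0 ?mul0r ?subr0 ?mulr1.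
- by rewrite /= coef0 add0n mulrC subrr.
have coef_step (a b c : {poly rat}) :
    (a + (1 + 'X) * b + 'X * c)`_s
      = a`_s + b`_s + (if s is s'.+1 then b`_s' + c`_s' else 0).
  by rewrite mulrDl mul1r !coefD !coefXM; case: s => [|s] /=; ring.
rewrite ballotSS coef_step !IHk; case: s {coef_step} => [|s]; rewrite ?IHk /=.
  by rewrite !addn0 !bin0 binS_pred natrD; ring.
rewrite !addSn !addnS /= !binS_pred /= !natrD.
ring.
Qed.

(** At [p = 1] the reflection formula gives a 2 by 2 determinant of binomials; multiplying by
    [s + 1] and absorbing factors yields the Narayana number. *)
Lemma narayana_ballot n : narayana n.+1 = ballot 'X 1 n.+1.
Proof.
apply/polyP=> s; rewrite ballot_coef add1n /= big_mkord coef_sum.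
have -> : \sum_(k < n.+2) ((('C(n.+1, k) * 'C(n, k))%:R / k.+1%:R : rat) *: 'X^k)`_s
   = ('C(n.+1, s) * 'C(n, s))%:R / s.+1%:R.
  have [ltsn|lens] := ltnP s n.+2.
    rewrite (bigD1 (Ordinal ltsn)) //= coefZ coefXn eqxx mulr1 big1 ?addr0 //.
    by move=> k; rewrite -val_eqE /= coefZ coefXn eq_sym => /negPf ->; rewrite mulr0.
  rewrite bin_small // mul0n mul0r big1 // => k _.
  by rewrite coefZ coefXn gtn_eqF ?mulr0 // (leq_trans _ lens).
apply: (canLR (mulfK _)); first by rewrite pnatr_eq0.
have e1 : s.+1%:R * 'C(n, s.+1)%:R = (n%:R - s%:R) * 'C(n, s)%:R :> rat.
  have [lesn|ltns] := leqP s n; last by rewrite !bin_small ?mulr0 // ltnW.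
  by rewrite -natrB // -!natrM mul_bin_left.
have e2 : s%:R * 'C(n, s)%:R = (n%:R - s%:R + 1) * (bin_pred n s)%:R :> rat.
  case: s {e1} => [|s]; first by rewrite mul0r mulr0.
  have [lesn|ltns] := leqP s n; last by rewrite /= !bin_small ?mulr0 // ltnW.
  rewrite -natrM mul_bin_left natrM natrB // -[s.+1%:R in RHS]natr1 /=; ring.
rewrite binS_pred natrM natrD; apply/esym.
set C := 'C(n, s)%:R; set C' := 'C(n, s.+1)%:R; set B := (bin_pred n s)%:R.
have -> : (C * C - B * C') * s.+1%:R = s%:R * C * C + C * C - B * (s.+1%:R * C').
  by rewrite -natr1; ring.
by rewrite e1 e2 /C /B; ring.
Qed.

Lemma coef_gm1_powE m K : coef_gm1_pow m K = ballot 'X m K.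
Proof.
(* Generalizing to all [j <= K] keeps the truncation order fixed while inducting on the power. *)
suff coef_pow j : (j <= K)%N -> (gamma_minus1_trunc K ^+ m)`_j = ballot 'X m j.
  exact: coef_pow.
have coef_trunc i : (i <= K)%N -> (gamma_minus1_trunc K)`_i = ballot 'X 1 i.
  move=> leiK; rewrite coef_sum.
  case: i leiK => [|i] ltiK.
    rewrite big_nat_cond big1 // => n /andP[/andP[n_gt0 _] _].
    by rewrite coefCM coefXn (ltn_eqF n_gt0) mulr0.
  rewrite (bigD1_seq i.+1) ?iota_uniq ?mem_index_iota //.
  rewrite coefCM coefXn eqxx mulr1 narayana_ballot big1 => [|n]; first exact: addr0.
  by rewrite coefCM coefXn eq_sym => /negPf ->; rewrite mulr0.
elim: m j => [|m IHm] j lejK; first by rewrite expr0 coef1 ballot0n.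
rewrite exprS coefM -(ballot_conv _ 1 m); apply: eq_bigr => i _.
have leij : (i <= j)%N by rewrite -ltnS.
by rewrite coef_trunc ?IHm // (leq_trans _ lejK) // leq_subr.
Qed.

Lemma hankelHE m N : hankelH m N = sqdet (fun i j => ballot 'X m (i + j)) N.
Proof.
congr (\det _); apply/matrixP=> i j; rewrite !mxE -PoszD.
have [lemij|ltijm] := leqP m (i + j).
  by rewrite subzn //= coef_gm1_powE subnK.
(* Negative indices, where [gamma2m] is 0 by convention, match [L_m] vanishing below degree [m]. *)
rewrite ballot_lt // -opprB subzn 1?ltnW // .
by case: (m - (i + j))%N (subn_gt0 (i + j) m) => [|k] /=; rewrite ltijm //.
Qed.

End Narayana.

(** * Evaluation of the Hankel determinants by residue modulo [m] *)

Theorem theorem1p4 (m : nat) (hm : (1 <= m)%N) :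
  [/\ hankelH m 0 = 1,
      (forall n : nat, (1 <= n)%N ->
         hankelH m (m * n) =
           - (xi1 m n) * 'X^((m * (n - 1) * (m * n - 2)) %/ 2) * qnum (n - 1) ('X^m)),
      (forall n : nat,
         hankelH m (m * n + 1) =
           (-1) ^+ m * (xi1 m n) * 'X^((m * m * n * (n - 1)) %/ 2) * qnum n ('X^m))
    & (forall N : nat, (forall n, N <> (m * n)%N) -> (forall n, N <> (m * n + 1)%N) ->
         hankelH m N = 0)].
Proof.
have dbl_bin2 n : (n * (n - 1) = 'C(n, 2) * 2)%N.
  rewrite bin2 subn1 muln2 -[LHS]odd_double_half.
  by case: n => // n; rewrite oddM /= andNb.
have xi1E n : xi1 m n = (-1) ^+ (n * 'C(m, 2)).
  by rewrite /xi1 -mulnA dbl_bin2 mulnA mulnK.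
split.
- by rewrite hankelHE sqdet0.
(* Here [r = m - 1], and the last block is antitriangular. *)
- case=> // n _; have -> : (m * n.+1 = (m * n + m.-1).+1)%N by lia.
  rewrite hankelHE sqdet_ballot_split ?prednK // xi1E subSS subn0.
  rewrite (@sqdet_antitrig _ _ ('X^(m * n))).
  (* The exponent is exhibited as an even number; [n = 0] is separate because subtraction
     truncates. *)
  + have -> : (m * n * ((m * n + m.-1).+1 - 2)
        = (m * m * 'C(n, 2) + m * n * m.-1) * 2)%N.
      rewrite mulnDl -(mulnA (m * m)%N 'C(n, 2)) -dbl_bin2; case: (n) => [|n']; first by rewrite !muln0.
      have -> : ((m * n'.+1 + m.-1).+1 - 2 = m * (n'.+1 - 1) + m.-1 * 2)%N by lia.
      by rewrite mulnDr !mulnA; congr (_ + _)%N; rewrite (mulnAC m _ m).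
    rewrite mulnK // exprD -exprM mulSn exprD.
    have -> : 'C(m, 2) = (m.-1 + 'C(m.-1, 2))%N.
      by case: (m) hm => // m' _; rewrite binS bin1 addnC.
    have -> : (-1) ^+ m = - (-1) ^+ m.-1 :> {poly rat}.
      by case: (m) hm => // m' _; rewrite exprS mulN1r.
    by rewrite /qnum exprD; ring.
  + by move=> i j *; apply: orth_gram_eq0; lia.
  + by move=> i j *; apply: orth_gram_diag; lia.
- move=> n; rewrite hankelHE addn1 -[(m * n)%N]addn0 sqdet_ballot_split // sqdet0 mulr1.
  rewrite xi1E -(mulnA (m * m)%N) dbl_bin2 mulnA mulnK // /qnum.
  ring.
move=> N neN0 neN1.
case: N neN0 neN1 => [/(_ 0)|N neN0 neN1]; first by rewrite muln0.
have eqN := divn_eq N m; rewrite mulnC in eqN.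
have ltrm : (N %% m < m)%N by rewrite ltn_mod.
(* The size is now [N.+1], so remainders [0] and [m - 1] of [N] are the excluded sizes; otherwise
   row 0 of the last block vanishes. *)
have neq0 : (N %% m <> 0)%N by move=> r0; apply: (neN1 (N %/ m)%N); lia.
have neq1 : ((N %% m).+1 <> m)%N by move=> r0; apply: (neN0 (N %/ m)%N.+1); lia.
rewrite hankelHE {1}eqN sqdet_ballot_split // (@sqdet_row0 _ _ _ 0) ?mulr0 //.
  by rewrite lt0n; apply/eqP.
move: (N %/ m)%N (N %% m)%N ltrm neq0 neq1 => q r ltrm neq0 neq1 j ltj.
by apply: orth_gram_eq0; lia.
Qed.
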